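(* Let $F$ be a Ferrers diagram of semiperimeter $n+1$ and let $D=(T,(a_1,\ldots,a_n))\in\mathsf{DecEWtab}(F)$ be a decorated EW-tableau. Then $D\in\mathsf{Rec}_{\mathsf{EW}}(F)$ if and only if $a_j<\nu_j(T)$ for all $j\in[1,n]$.
   Context: Ferrers diagrams and graphs: a Ferrers diagram $F$ (English convention) of semiperimeter $n+1$ has rows and columns labeled by $0,\ldots,n$: the $n+1$ unit steps of its south-east boundary path, traversed from top-right to bottom-left, are labeled $0,\ldots,n$; a vertical step labels the row it bounds, a horizontal step the column it bounds (top row labeled $0$). $\mathsf{rows}(F)$, $\mathsf{cols}(F)$ are the label sets; $F$ has a cell in row $i$, column $j$ iff $i<j$. $G(F)$ has vertex set $\{0,\ldots,n\}$ with edges $\{i,j\}$ for $i\in\mathsf{rows}(F)$, $j\in\mathsf{cols}(F)$, $i<j$. Sandpile model on $G(F)$ with sink $0$: configurations $c\in\mathbb{N}^n$; non-sink $v$ unstable if $c_v\ge\deg(v)$; toppling sends one grain to each neighbour (grains to $0$ disappear); toppling the sink adds one grain to each neighbour of $0$. Recurrent: stable configurations obtainable from $c_v=\deg(v)-1$ by adding grains and stabilizing; $\mathsf{Rec}(G)$ their set; $\mathsf{Rec}^{\mathsf{min}}(G)$: recurrent configurations of minimal total grain count. Canonical toppling of a recurrent $c$: topple the sink ($U^{(0)}_c=\{0\}$), then alternately topple simultaneously all unstable vertices in $\mathsf{cols}(F)$ ($V^{(1)}_c$), all unstable in $\mathsf{rows}(F)$ ($U^{(1)}_c$), etc.; $\mathsf{CanonTop}(c)=(U^{(0)}_c,V^{(1)}_c,U^{(1)}_c,\ldots)$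 is an ordered partition of $\{0,\ldots,n\}$. For $c\in\mathsf{Rec}(G(F))$, $\mathsf{minrec}(c)$ is the configuration $m$ with $m_j=|\{\ell\in V^{(k)}_c: j<\ell,\ k>i\}|$ if $j\in U^{(i)}_c$ and $m_j=|\{\ell\in U^{(k)}_c: j>\ell,\ k\ge i\}|$ if $j\in V^{(i)}_c$; it is a minimal recurrent configuration. EW-tableaux: $0/1$-fillings $T$ of $F$ ($T_{ij}$ = entry in row $i$, column $j$) with top row all 1s, a 0 in every other row, and no rectangle with 0s in two diagonally opposite corners and 1s in the other two; $\mathsf{EWtab}(F)$ is their set. $\phi_{TC}(T)$ is the configuration with $c_i$ = number of 1s in row $i$ ($i\in\mathsf{rows}(F)$), $c_i$ = number of 0s in column $i$ ($i\in\mathsf{cols}(F)$); $\phi_{TC}$ is a bijection $\mathsf{EWtab}(F)\to\mathsf{Rec}^{\mathsf{min}}(G(F))$ with inverse denoted $\phi_{CT}$. $\mathsf{CanonTop}(T):=\mathsf{CanonTop}(\phi_{TC}(T))$. Decorated EW-tableaux: $\mathsf{DecEWtab}(F)$ is the set of pairs $(T,(x_1,\ldots,x_n))$ with $T\in\mathsf{EWtab}(F)$, $0\le x_i<$ (number of 0s in row $i$ of $T$) for $i\in\mathsf{rows}(F)$, and $0\le x_i<$ (number of 1s in column $i$ of $T$) for $i\in\mathsf{cols}(F)$. Define $\psi:\mathsf{Rec}(G(F))\to\mathsf{DecEWtab}(F)$ by $\psi(x)=(\phi_{CT}(\mathsf{minrec}(x)),(x_1-\mathsf{minrec}(x)_1,\ldots,x_n-\mathsf{minrec}(x)_n))$,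 and $\mathsf{Rec}_{\mathsf{EW}}(F)=\psi(\mathsf{Rec}(G(F)))$. Supplementary tableau $S=S(T)$: the $|\mathsf{rows}(F)|\times|\mathsf{cols}(F)|$ array with $S_{ij}=1$ if row label $i$ lies in an earlier block of $\mathsf{CanonTop}(T)$ than column label $j$, else $0$. An entry $x$ of $T$ at $(j,k)$ is a cornersupport entry iff there exist a row $j'\ne j$ and column $k'\ne k$ with $S_{j'k'}\ne x$ and $S_{j'k}=S_{jk'}=x$. For $j\in[1,n]$, $\nu_j(T)$ is the number of non-cornersupport 0s in row $j$ of $T$ if $j\in\mathsf{rows}(F)$, and the number of non-cornersupport 1s in column $j$ of $T$ if $j\in\mathsf{cols}(F)$. *)

(* Defs.v *)
From mathcomp Require Import all_boot.
Set Implicit Arguments.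
Unset Strict Implicit.
Unset Printing Implicit Defensive.

(* A Ferrers diagram F of semiperimeter n+1 is encoded by the set R of row
   labels (a subset of {0,...,n}); column labels are the complement.
   Validity of the boundary path: 0 is a row label and n a column label. *)
Definition ferrers (n : nat) (R : {set 'I_n.+1}) : Prop :=
  ord0 \in R /\ (ord_max : 'I_n.+1) \notin R.

Section Ferrers.
Variables (n : nat) (R : {set 'I_n.+1}).

Definition vtx := 'I_n.+1.
(* configurations: value at the sink 0 is unused and set to 0 *)
Definition config := {ffun vtx -> nat}.

Definition cell (i j : vtx) : bool := [&& i \in R, j \notin R & i < j].

Definition adj (u v : vtx) : bool := cell u v || cell v u.

Definition deg (v : vtx) : nat := #|[set u | adj v u]|.

Definition stable (c : config) : Prop :=
  forall v : vtx, v != ord0 -> c v < deg v.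

Definition topple (v : vtx) (c : config) : config :=
  [ffun u => if u == ord0 then 0 else (c u + adj v u) - (if u == v then deg v else 0)].

Inductive reach : config -> config -> Prop :=
  | reach_refl (c : config) : reach c c
  | reach_step (c : config) (v : vtx) (c' : config) : v != ord0 -> deg v <= c v -> reach (topple v c) c' -> reach c c'.

Definition cmax : config := [ffun v => if v == ord0 then 0 else (deg v).-1].

Definition addc (c d : config) : config := [ffun v => c v + d v].

Definition recurrent (c : config) : Prop :=
  c ord0 = 0 /\ stable c /\
  exists d : config, d ord0 = 0 /\ reach (addc cmax d) c.

Definition topple_set (B : {set vtx}) (c : config) : config :=
  [ffun u => if u == ord0 then 0 else
     (c u + #|[set v in B | adj v u]|) - (if u \in B then deg u else 0)].

Fixpoint canon_rec (k : nat) (col : bool) (c : config) : seq {set vtx} :=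
  match k with
  | 0 => [::]
  | k'.+1 =>
      let B := [set v : vtx | [&& v != ord0, (v \notin R) == col & deg v <= c v]] in
      B :: canon_rec k' (~~ col) (topple_set B c)
  end.

(* CanonTop(c) = (U^(0), V^(1), U^(1), V^(2), ...) ; block at position 2i is
   U^(i), block at position 2i-1 is V^(i).  Enough phases are simulated;
   trailing phases are empty. *)
Definition canontop (c : config) : seq {set vtx} :=
  [set ord0] :: canon_rec (2 * n.+1)
    true [ffun u => if u == ord0 then 0 else c u + adj ord0 u].

Definition blk (c : config) (v : vtx) : nat := find (fun B : {set vtx} => v \in B) (canontop c).

Definition minrec (c : config) : config :=
  [ffun j => if j == ord0 then 0 else
     if j \in R then #|[set l | [&& l \notin R, j < l & odd (blk c l) && (blk c j < blk c l)]]|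
     else #|[set l | [&& l \in R, l < j & ~~ odd (blk c l) && (blk c j < blk c l)]]|].

(* 0/1 fillings: T (i,j) for the cell in row i column j; entries outside F
   are normalized to false *)
Definition filling := {ffun vtx * vtx -> bool}.

Definition isEW (T : filling) : bool :=
  [&& [forall i, forall j, ~~ cell i j ==> ~~ T (i, j)],
      [forall j, cell ord0 j ==> T (ord0, j)],
      [forall i, ((i \in R) && (i != ord0)) ==> [exists j, cell i j && ~~ T (i, j)]] &
      [forall i, forall i', forall j, forall j',
         [&& cell i j, cell i j', cell i' j, cell i' j', i != i' & j != j'] ==>
         ~~ [&& ~~ T (i, j), ~~ T (i', j'), T (i, j') & T (i', j)]]].

Definition zeros_row (T : filling) (i : vtx) : nat := #|[set j | cell i j && ~~ T (i, j)]|.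
Definition ones_col (T : filling) (j : vtx) : nat := #|[set i | cell i j && T (i, j)]|.

Definition phiTC (T : filling) : config :=
  [ffun v => if v == ord0 then 0 else
     if v \in R then #|[set j | cell v j && T (v, j)]|
     else #|[set i | cell i v && ~~ T (i, v)]|].

(* inverse of phiTC (a bijection EWtab -> Rec^min) *)
Definition phiCT (m : config) : filling :=
  odflt [ffun => false] [pick T | isEW T && (phiTC T == m)].

Definition isDecEW (T : filling) (a : config) : Prop :=
  isEW T /\ a ord0 = 0 /\
  forall i : vtx, i != ord0 ->
    (i \in R -> a i < zeros_row T i) /\ (i \notin R -> a i < ones_col T i).

Definition psi (x : config) : filling * config :=
  (phiCT (minrec x), [ffun v => x v - minrec x v]).

Definition RecEW (D : filling * config) : Prop :=
  exists x : config, recurrent x /\ psi x = D.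

Definition suppl (T : filling) (i j : vtx) : bool :=
  blk (phiTC T) i < blk (phiTC T) j.

Definition cornersupport (T : filling) (j k : vtx) : bool :=
  [exists j', exists k',
     [&& j' \in R, k' \notin R, j' != j, k' != k,
         suppl T j' k' != T (j, k),
         suppl T j' k == T (j, k) & suppl T j k' == T (j, k)]].

Definition nu (T : filling) (j : vtx) : nat :=
  if j \in R then #|[set k | [&& cell j k, ~~ T (j, k) & ~~ cornersupport T j k]]|
  else #|[set i | [&& cell i j, T (i, j) & ~~ cornersupport T i j]]|.

End Ferrers.

(* Main.v *)
(* A function b giving the phase at which each vertex fires is the canonical toppling of
   a configuration x exactly when, for every v <> 0, x v is at least the number of
   neighbours of v firing later than v, and exceeds it by less than the number of
   neighbours firing in the phase just before v.  By Dhar's burning criterion the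
   configurations with such a b are the recurrent ones, and minrec x is the lower bound,
   so only the size of the phase preceding v constrains a_v.
   An EW-tableau orients G(F) by sending row i to column j when T(i,j) = 1; the
   absence of alternating rectangles makes this orientation acyclic, and then it is the
   one induced by canonical toppling.  A corner support of the entry for an arc u -> v is
   a pair of vertices firing in phases strictly between those of u and v, so the
   non-cornersupport entries counted by nu_v are the neighbours in the phase just before v. *)
Require Import Defs.
From mathcomp Require Import all_boot.
From mathcomp Require Import zify.

Section Sandpile.
Set Implicit Arguments.
Unset Strict Implicit.

Variables (n : nat) (R : {set 'I_n.+1}).
Implicit Types (u v w : vtx n) (A B X : {set vtx n}) (c d : config n) (b : vtx n -> nat).

Local Notation adj := (adj R).
Local Notation deg := (deg R).
Local Notation cell := (cell R).
Local Notation topple := (topple R).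
Local Notation reach := (reach R).
Local Notation blk := (blk R).

(** * Neighbour counts and firing phases *)

Definition nbrs_in A v := #|[set u in A | adj u v]|.

Definition before b v := #|[set u | adj v u & b u < b v]|.
Definition later b v := #|[set u | adj v u & b v < b u]|.
Definition previous b v := #|[set u | adj v u & (b u).+1 == b v]|.

(** Absence of forbidden subconfigurations in Dhar's sense: the toppling invariant through which
    recurrence is tested. *)
Definition no_forbidden c :=
  forall X, X != set0 -> ord0 \notin X -> exists2 v, v \in X & nbrs_in X v <= c v.

(* [b] gives the phase at which each vertex fires in the canonical toppling of [c]:
   [later b v] is the least load with which [v] can fire at phase [b v], and
   [later b v + previous b v] is the least load with which it fires before. *)
Definition schedule c b :=
  [/\ b ord0 = 0, forall v, odd (b v) = (v \notin R)
    & forall v, v != ord0 -> later b v <= c v < later b v + previous b v].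

Lemma adjC u v : adj u v = adj v u.
Proof. by rewrite /Defs.adj orbC. Qed.

Lemma adj_parity u v : adj u v -> (u \in R) = ~~ (v \in R).
Proof.
case/orP=> /and3P[iR jR _]; first by rewrite iR jR.
by rewrite iR (negbTE jR).
Qed.

Lemma adj_irrefl v : adj v v = false.
Proof. by apply/negP => /adj_parity; case: (v \in R). Qed.

Lemma nbrs_in_setT v : nbrs_in setT v = deg v.
Proof. by apply: eq_card => u; rewrite !inE adjC. Qed.

Lemma nbrs_inS A B v : A \subset B -> nbrs_in A v <= nbrs_in B v.
Proof.
move=> sAB; apply/subset_leq_card/subsetP => u.
by rewrite !inE => /andP[/(subsetP sAB)-> ->].
Qed.

Lemma nbrs_in_le_deg A v : nbrs_in A v <= deg v.
Proof. by rewrite -nbrs_in_setT nbrs_inS ?subsetT. Qed.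

Lemma nbrs_inU A B v : [disjoint A & B] ->
  nbrs_in (A :|: B) v = nbrs_in A v + nbrs_in B v.
Proof.
move=> dAB; rewrite /nbrs_in !setIdE setIUl cardsU -setIIl.
by rewrite (disjoint_setI0 dAB) set0I cards0 subn0.
Qed.

Lemma nbrs_in1 u v : nbrs_in [set u] v = adj u v.
Proof.
rewrite /nbrs_in; have [auv|/negbTE nauv] := boolP (adj u v).
  transitivity #|[set u]|; last by rewrite cards1.
  apply: eq_card => w; rewrite !inE.
  by case: eqP => // ->; rewrite auv.
by apply: eq_card0 => w; rewrite !inE; case: eqP => // ->.
Qed.

Lemma nbrs_inC A v : deg v = nbrs_in A v + nbrs_in (~: A) v.
Proof. by rewrite -nbrs_in_setT -(setUCr A) nbrs_inU // -setI_eq0 setICr. Qed.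

Lemma before_nbrs b v : before b v = nbrs_in [set u | b u < b v] v.
Proof. by apply: eq_card => u; rewrite !inE adjC andbC. Qed.

Lemma adj_odd b u v : (forall v, odd (b v) = (v \notin R)) -> adj u v ->
  odd (b u) = ~~ odd (b v).
Proof. by move=> bR /adj_parity uv; rewrite !bR uv. Qed.

Lemma deg_before_later b v : (forall v, odd (b v) = (v \notin R)) ->
  deg v = before b v + later b v.
Proof.
move=> bR; rewrite (nbrs_inC [set u | b u < b v]) before_nbrs; congr addn.
apply: eq_card => u; rewrite !inE adjC; case auv: (adj v u); rewrite ?andbF ?andbT //=.
by have := adj_odd bR auv; lia.
Qed.

(** Rows have even phases and columns odd ones, so a neighbour firing before [v] does so one phase
    earlier or at least three. *)
Lemma before_previous b v : (forall v, odd (b v) = (v \notin R)) ->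
  before b v = nbrs_in [set u | (b u).+2 < b v] v + previous b v.
Proof.
move=> bR; rewrite before_nbrs.
have -> : previous b v = nbrs_in [set u | (b u).+1 == b v] v.
  by apply: eq_card => u; rewrite !inE adjC andbC.
rewrite -nbrs_inU; last first.
  by rewrite -setI_eq0; apply/eqP/setP => u; rewrite !inE; lia.
apply: eq_card => u; rewrite !inE adjC; case auv: (adj v u); rewrite ?andbF ?andbT //=.
by have := adj_odd bR auv; lia.
Qed.

(** * Recurrence and forbidden subconfigurations *)

Lemma toppleC u v c : u != v -> deg u <= c u -> deg v <= c v ->
  topple u (topple v c) = topple v (topple u c).
Proof.
move=> uv cu cv; apply/ffunP => w; rewrite !ffunE; case: eqP => // _.
case: (w =P u) => [->|_]; first by rewrite (negbTE uv); lia.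
by case: (w =P v) => [->|_]; lia.
Qed.

Lemma topple_ge u v c : u != v -> u != ord0 -> c u <= topple v c u.
Proof. by move=> uv u0; rewrite ffunE (negbTE u0) (negbTE uv); lia. Qed.

Lemma reach_trans c1 c2 c3 : reach c1 c2 -> reach c2 c3 -> reach c1 c3.
Proof.
elim=> // {}c1 v {}c2 v0 cv _ IH r; exact: reach_step v0 cv (IH r).
Qed.

(** Since [c'] is stable, any sequence reaching it topples [v] at some point; commutation moves the
    first such toppling to the front. *)
Lemma reach_topple c c' v : reach c c' -> stable R c' -> v != ord0 -> deg v <= c v ->
  reach (topple v c) c'.
Proof.
elim=> {c c'} [c|c u c' u0 cu r IH] st v0 cv.
  by have := st v v0; rewrite ltnNge cv.
have [->//|vu] := eqVneq v u.
have /(IH st v0) : deg v <= topple u c v by apply: leq_trans (topple_ge _ vu v0).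
rewrite toppleC //; apply: (reach_step u0).
by apply: leq_trans cu (topple_ge _ _ u0); rewrite eq_sym.
Qed.

Lemma reach_confluent c c1 c2 : reach c c1 -> stable R c1 -> reach c c2 -> reach c2 c1.
Proof.
move=> r1 st r2; elim: r2 r1 => // {}c v {}c2 v0 cv _ IH r1.
exact/IH/reach_topple.
Qed.

Lemma reach_addc c c' d : d ord0 = 0 -> reach c c' -> reach (addc c d) (addc c' d).
Proof.
move=> d0; elim=> {c c'} [c|c v c' v0 cv _ IH]; first exact: reach_refl.
apply: (reach_step v0); first by rewrite ffunE; lia.
suff -> : topple v (addc c d) = addc (topple v c) d by [].
apply/ffunP => u; rewrite !ffunE; case: (u =P ord0) => [->|_]; first by rewrite d0.
by case: (u =P v) => [->|_]; lia.
Qed.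

Lemma reach_no_forbidden c c' : reach c c' -> no_forbidden c -> no_forbidden c'.
Proof.
elim=> // {}c v {}c' v0 cv _ IH nf; apply: IH => X X0 oX.
have neq0 u : u \in X -> (u == ord0) = false.
  by move=> uX; apply: contraNF oX => /eqP<-.
have [vX|vX] := boolP (v \in X); last first.
  have [u uX cu] := nf X X0 oX; exists u => //; apply: leq_trans cu (topple_ge _ _ _).
    by apply: contraNneq vX => <-.
  by rewrite neq0.
have XD : X = (X :\ v) :|: [set v] by rewrite setUC setD1K.
have dis : [disjoint X :\ v & [set v]] by rewrite disjoint_sym disjoints1 !inE eqxx.
(* The criterion is applied to [X] without [v]: the vertex [u] found there gains a grain exactly
   when it is a neighbour of [v], which pays for putting [v] back. *)
have [Xv|/nf[|u]] := eqVneq (X :\ v) set0.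
- exists v => //; rewrite XD nbrs_inU // Xv nbrs_in1 adj_irrefl.
  by rewrite /nbrs_in (eq_card0 (A := [set u in set0 | adj u v])) // => u; rewrite !inE.
- by rewrite !inE negb_and oX orbT.
rewrite !inE => /andP[uv uX] cu; exists u => //.
rewrite {1}XD nbrs_inU // nbrs_in1 ffunE neq0 // (negbTE uv).
by lia.
Qed.

Hypothesis ferrersR : ferrers R.

Lemma sink_row : ord0 \in R. Proof. by case: ferrersR. Qed.

Lemma last_column : (ord_max : 'I_n.+1) \notin R. Proof. by case: ferrersR. Qed.

Lemma adj_sink v : v \notin R -> adj ord0 v.
Proof.
move=> vR; apply/orP; left; rewrite /Defs.cell sink_row vR lt0n /=.
by apply: contraNneq vR => v0; rewrite (_ : v = ord0) ?sink_row //; apply: val_inj.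
Qed.

Lemma adj_last v : v \in R -> adj ord_max v.
Proof.
move=> vR; apply/orP; right; rewrite /Defs.cell vR last_column ltn_neqAle -ltnS ltn_ord /=.
by rewrite andbT; apply: contraTneq vR => vn; rewrite (_ : v = ord_max) ?last_column //; apply: val_inj.
Qed.

(** It suffices to find a vertex of [X] with a neighbour outside [X]. One exists because the sink is
    adjacent to every column and the last column to every row. *)
Lemma cmax_no_forbidden d : no_forbidden (addc (cmax R) d).
Proof.
move=> X /set0Pn[w wX] oX.
suff [v vX [u uX auv]] : exists2 v, v \in X & exists2 u, u \notin X & adj u v.
  exists v => //; rewrite !ffunE; have -> : (v == ord0) = false.
    by apply: contraNF oX => /eqP<-.
  have : 0 < nbrs_in (~: X) v by apply/card_gt0P; exists u; rewrite !inE uX.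
  by rewrite (nbrs_inC X); lia.
have [wR|wR] := boolP (w \in R); last by exists w => //; exists ord0 => //; exact: adj_sink.
have [mX|mX] := boolP (ord_max \in X).
  by exists ord_max => //; exists ord0 => //; exact: adj_sink last_column.
by exists w => //; exists ord_max => //; exact: adj_last.
Qed.

Lemma recurrent_no_forbidden c : recurrent R c -> no_forbidden c.
Proof. by case=> _ [_ [d [_ /reach_no_forbidden]]]; apply; exact: cmax_no_forbidden. Qed.

(** * Burning *)

(** The result of toppling each vertex of [A] once; [legal] guarantees that the truncated
    subtraction is exact. *)
Definition fire_set c A : config n :=
  [ffun u => if u == ord0 then 0 else c u + nbrs_in A u - (if u \in A then deg u else 0)].

Definition legal c A := forall u, u \in A -> u != ord0 -> deg u <= c u + nbrs_in A u.

Lemma topple_set_fire c A B : legal c A -> ord0 \notin B -> [disjoint A & B] ->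
  topple_set R B (fire_set c A) = fire_set c (A :|: B).
Proof.
move=> lA oB dAB; apply/ffunP => u; rewrite !ffunE nbrs_inU // inE.
case: (u =P ord0) => // /eqP u0.
rewrite -/(nbrs_in B u).
have [uA|uA] := boolP (u \in A); last by rewrite /=; lia.
by rewrite (disjointFr dAB uA) /=; have := lA u uA u0; lia.
Qed.

Lemma topple_fire c A v : legal c A -> v != ord0 -> v \notin A ->
  topple v (fire_set c A) = fire_set c (v |: A).
Proof.
move=> lA v0 vA; rewrite setUC -topple_set_fire //; first last.
- by rewrite disjoint_sym disjoints1.
- by rewrite inE eq_sym.
apply/ffunP => u; rewrite !ffunE inE; case: eqP => // _.
rewrite -/(nbrs_in [set v] u) nbrs_in1.
by case: (u =P v) => [->|].
Qed.

Lemma legalS c A B : legal c A -> A \subset B ->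
  (forall u, u \in B -> u \notin A -> u != ord0 -> deg u <= c u + nbrs_in A u) -> legal c B.
Proof.
move=> lA sAB lB u uB u0; have := nbrs_inS u sAB.
by have [/lA/(_ u0)|/(lB u uB)/(_ u0)] := boolP (u \in A); lia.
Qed.

(** Firing every vertex once, the sink included, restores [c], so it remains to fire the vertices
    outside [A] in the order of [b]. *)
Lemma reach_fire_set c b A : c ord0 = 0 ->
  (forall v, v != ord0 -> deg v <= c v + before b v) ->
  legal c A -> ord0 \in A -> (forall u w, u \in A -> b w < b u -> w \in A) ->
  reach (fire_set c A) c.
Proof.
move=> c0 cb; have [m] := ubnP #|~: A|; elim: m A => // m IH A ltm lA oA dA.
have [/eqP A0|/set0Pn[w0 w0A]] := boolP (~: A == set0).
  have AT : A = setT by rewrite -(setCK A) A0 setC0.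
  rewrite (_ : fire_set c A = c); first exact: reach_refl.
  apply/ffunP => u; rewrite ffunE AT nbrs_in_setT inE addnK.
  by case: eqP => // ->; rewrite c0.
(* For an unfired vertex of least phase, all neighbours of smaller phase lie in [A], which makes it
   unstable. *)
have [v vA vmin] : exists2 v, v \notin A & forall u, u \notin A -> b v <= b u.
  rewrite inE in w0A.
  by case: (arg_minnP (P := fun u => u \notin A) b w0A) => v; exists v.
have v0 : v != ord0 by apply: contraNneq vA => ->.
have cv : deg v <= c v + nbrs_in A v.
  apply: leq_trans (cb v v0) _; rewrite leq_add2l before_nbrs nbrs_inS //.
  apply/subsetP => u; rewrite inE => buv; apply: contraTT buv => uA.
  by rewrite -leqNgt vmin.
apply: (reach_step v0); first by rewrite ffunE (negbTE v0) (negbTE vA) subn0.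
rewrite topple_fire //; apply: IH.
- rewrite -ltnS; apply: leq_trans ltm; rewrite ltnS; apply: proper_card.
  rewrite setCU properE subsetIr; apply/subsetPn; exists v; rewrite !inE ?vA //.
  by rewrite eqxx.
- apply: legalS lA (subsetUr _ _) _ => u.
  by rewrite !inE => /orP[/eqP->//|->].
- by rewrite inE oA orbT.
- move=> u w; rewrite !inE => /orP[/eqP->|uA] bw; last by rewrite (dA u w uA bw) orbT.
  have [//|wA] := boolP (w \in A); rewrite ?orbT // ltnNge in bw *.
  by rewrite vmin in bw.
Qed.

Definition sink_load k : config n := [ffun u => k * adj ord0 u].

Lemma sink_load0 k : sink_load k ord0 = 0.
Proof. by rewrite ffunE adj_irrefl muln0. Qed.

Lemma reach_burn c b k : c ord0 = 0 -> b ord0 = 0 ->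
  (forall v, v != ord0 -> deg v <= c v + before b v) ->
  reach (addc c (sink_load k)) c.
Proof.
move=> c0 b0 cb; elim: k => [|k IH].
  rewrite (_ : addc c _ = c); first exact: reach_refl.
  by apply/ffunP => u; rewrite !ffunE addn0.
apply: reach_trans IH.
have -> : addc c (sink_load k.+1) = addc (fire_set c [set ord0]) (sink_load k).
  apply/ffunP => u; rewrite !ffunE nbrs_in1 inE.
  by case: eqP => [->|_]; rewrite ?c0 ?adj_irrefl; lia.
apply: reach_addc; rewrite ?sink_load0 //; apply: (reach_fire_set (b := b)) => //.
- by move=> u; rewrite inE => ->.
- by rewrite inE.
- by move=> u w; rewrite !inE => /eqP->; rewrite b0.
Qed.

(* Firing the last column repeatedly feeds every row, while the sink feeds every column. *)
Lemma reach_large c k t : c ord0 = 0 -> t * deg ord_max <= k ->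
  exists e, [/\ reach (addc c (sink_load k)) e, e ord0 = 0
    & forall u, u != ord0 ->
        k * adj ord0 u + t * adj ord_max u <= e u + (u == ord_max) * (t * deg ord_max)].
Proof.
move=> c0; have max0 : ord_max != ord0 :> 'I_n.+1 by apply: contraNneq last_column => ->; exact: sink_row.
elim: t => [|t IH] tk.
  exists (addc c (sink_load k)); split; first exact: reach_refl.
    by rewrite ffunE c0 sink_load0.
  by move=> u _; rewrite !ffunE; lia.
have [|e [re e0 le]] := IH; first by lia.
have emax : deg ord_max <= e ord_max.
  have := le _ max0; rewrite eqxx (adj_sink last_column) adj_irrefl; lia.
exists (topple ord_max e); split.
- apply: reach_trans re _; apply: reach_step max0 emax _; exact: reach_refl.
- by rewrite ffunE.
move=> u u0; have := le u u0; rewrite ffunE (negbTE u0).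
by case: (u =P ord_max) => [->|_]; lia.
Qed.

(** A large sink load on [c] leads to some [e] above the maximal stable configuration, and also
    burns back to [c]; by confluence [e] stabilizes to [c]. *)
Lemma burning_recurrent c b : c ord0 = 0 -> stable R c -> b ord0 = 0 ->
  (forall v, v != ord0 -> deg v <= c v + before b v) -> recurrent R c.
Proof.
move=> c0 st b0 cb; split=> //; split=> //.
(* Every degree is at most [n.+1]. Firing the last column [n.+1] times gives each row that many
   grains, and the sink load pays for this with [n.+1] grains to spare. *)
have [e [re e0 le]] := reach_large (t := n.+1) c0 (leq_addr n.+1 (n.+1 * deg ord_max)).
exists [ffun u => e u - cmax R u]; split; first by rewrite !ffunE e0.
rewrite (_ : addc _ _ = e); first exact: reach_confluent (reach_burn _ c0 b0 cb) st re.
apply/ffunP => u; rewrite !ffunE; case: eqP => [->|/eqP u0]; first by rewrite e0.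
apply: subnKC; apply: leq_trans (leq_pred _) _.
have degn : deg u <= n.+1 by rewrite -[X in _ <= X]card_ord max_card.
apply: leq_trans degn _; have := le u u0.
have [uR|/adj_sink->] := boolP (u \in R); last by case: eqP => _; lia.
rewrite (adj_last uR) (_ : (u == ord_max) = false); first by lia.
by apply: contraNF last_column => /eqP<-.
Qed.

(** * Canonical toppling *)

(** The union of the first blocks of the canonical toppling, computed from the original loads
    instead of the successive configurations. *)
Fixpoint fired c k : {set vtx n} :=
  if k is k'.+1 then
    fired c k' :|: [set v | [&& v != ord0, (v \notin R) == odd k
                              & deg v <= c v + nbrs_in (fired c k') v]]
  else [set ord0].

Lemma fired_sub c k l : k <= l -> fired c k \subset fired c l.
Proof.
move/subnK <-; elim: (l - k) => // m IH.
exact: subset_trans IH (subsetUl _ _).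
Qed.

Lemma sink_fired c k : ord0 \in fired c k.
Proof. by apply: (subsetP (fired_sub c (leq0n k))); rewrite inE. Qed.

Lemma fired_legal c k : legal c (fired c k).
Proof.
elim: k => [|k IH]; first by move=> u; rewrite inE => ->.
apply: legalS IH (subsetUl _ _) _ => u.
by rewrite /= !inE => /orP[->//|/and3P[]].
Qed.

Lemma canon_recE c k h : stable R c ->
  canon_rec R k (odd h.+1) (fire_set c (fired c h)) =
  [seq fired c i.+1 :\: fired c i | i <- iota h k].
Proof.
move=> st; elim: k h => //= k IH h.
have -> : [set v : vtx n | [&& v != ord0, (v \notin R) == ~~ odd h
    & deg v <= fire_set c (fired c h) v]] = fired c h.+1 :\: fired c h.
  apply/setP => v; rewrite !inE ffunE; case: (v =P ord0) => [->|/eqP v0] /=.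
    by rewrite sink_fired.
  have [vF|vF] := boolP (v \in fired c h); last by rewrite subn0.
  (* A fired vertex is not unstable again: it has sent [deg v] grains, received at most [deg v], and
     started with a stable load. *)
  rewrite leqNgt (_ : _ < deg v) ?andbF //.
  by have := st v v0; have := nbrs_in_le_deg (fired c h) v; lia.
congr (_ :: _); rewrite topple_set_fire.
- rewrite -{1}(setIidPr (fired_sub c (leqnSn h))) setID; exact: (IH h.+1).
- exact: fired_legal.
- by rewrite !inE sink_fired.
- by rewrite -setI_eq0 setIDA setIC -setIDA setDv setI0.
Qed.

Lemma canontopE c : stable R c ->
  canontop R c = [set ord0] :: [seq fired c i.+1 :\: fired c i | i <- iota 0 (2 * n.+1)].
Proof.
move=> st; rewrite /canontop -canon_recE //; congr (_ :: canon_rec _ _ _ _).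
apply/ffunP => u; rewrite !ffunE nbrs_in1 inE.
by case: eqP => // _; rewrite subn0.
Qed.

Lemma find_first (S : Type) (x0 : S) (a : pred S) s i :
  i < size s -> a (nth x0 s i) -> (forall j, j < i -> ~~ a (nth x0 s j)) -> find a s = i.
Proof.
move=> lts ai nai; apply/anti_leq/andP; split; rewrite leqNgt.
  by apply/negP => /(before_find x0); rewrite ai.
apply/negP => lti; have := nai _ lti; rewrite nth_find // has_find.
exact: ltn_trans lti lts.
Qed.

Lemma blkE c v k : stable R c -> k <= 2 * n.+1 -> v \in fired c k ->
  (forall j, j < k -> v \notin fired c j) -> blk c v = k.
Proof.
move=> st kn vk vj; rewrite /Defs.blk canontopE //; move Es: (map _ _) => s /=.
case: k => [|k] in kn vk vj *; first by rewrite vk.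
rewrite (negbTE (vj 0 _)) //; congr S; rewrite -{}Es; apply: (find_first (x0 := set0)).
- by rewrite size_map size_iota.
- by rewrite (nth_map 0) ?size_iota // nth_iota // !in_setD vk vj.
move=> j jk; rewrite (nth_map 0) ?size_iota ?nth_iota; try by lia.
by rewrite in_setD (negbTE (vj j.+1 _)) ?andbF.
Qed.

(** Applied to the unfired vertices, the criterion gives one that is ready to fire. Two consecutive
    phases serve both columns and rows, so each pair of phases adds a vertex until all have
    fired. *)
Lemma fired_full c : no_forbidden c -> fired c (2 * n) = setT.
Proof.
move=> nf.
suff H k : (k < #|fired c (2 * k)|) || (fired c (2 * k) == setT).
  have := H n; case: eqP => // _; rewrite orbF => ltn.
  by apply/eqP; rewrite eqEcard subsetT cardsT card_ord.
elim: k => [|k IH]; first by rewrite cards1.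
have sub := fired_sub c (_ : 2 * k <= 2 * k.+1).
have [full|nfull] := eqVneq (fired c (2 * k)) setT.
  by rewrite orbC -subTset -full sub // leq_mul.
rewrite (negbTE nfull) orbF in IH.
have [||v] := nf (~: fired c (2 * k)).
- by rewrite -setCT (inj_eq (can_inj (@setCK _))).
- by rewrite inE sink_fired.
rewrite inE => vF cv; apply/orP; left; apply: leq_ltn_trans IH _; apply: proper_card.
have mulnk : 2 * k.+1 = (2 * k).+2 by lia.
rewrite properE sub; last by lia.
apply/subsetPn; exists v => //.
have v0 : v != ord0 by apply: contraNneq vF => ->; exact: sink_fired.
have deg_le : deg v <= c v + nbrs_in (fired c (2 * k)) v.
  by rewrite (nbrs_inC (fired c (2 * k))); lia.
have deg_le1 := leq_trans deg_le (leq_add (leqnn _) (nbrs_inS v (fired_sub c (leqnSn (2 * k))))).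
rewrite mulnk !in_setU !inE v0 deg_le deg_le1 /=.
by case: (v \in R); case: (odd (2 * k)); rewrite ?orbT.
Qed.

Lemma no_forbidden_schedule c : stable R c -> no_forbidden c -> exists b, schedule c b.
Proof.
move=> st nf; have ex v : exists k, v \in fired c k.
  by exists (2 * n); rewrite fired_full ?inE.
pose b v := ex_minn (ex v).
have firedE k : fired c k = [set v | b v <= k].
  apply/setP => v; rewrite inE /b; case: ex_minnP => m vm minm.
  apply/idP/idP => [/minm//|/(fired_sub c)/subsetP]; exact.
have b0 : b ord0 = 0.
  by apply/eqP; rewrite -leqn0; have := sink_fired c 0; rewrite firedE inE.
have bfire v : v != ord0 -> exists k, [/\ b v = k.+1, odd k.+1 = (v \notin R) &
    deg v <= c v + nbrs_in (fired c k) v].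
  move=> v0; case bv: (b v) => [|k].
    have : v \in fired c 0 by rewrite firedE inE bv.
    by rewrite inE (negbTE v0).
  exists k; have : v \in fired c k.+1 by rewrite firedE inE bv.
  rewrite /= in_setU {1}firedE inE bv ltnn inE v0 => /= /andP[/eqP-> ?].
  by split.
have bR v : odd (b v) = (v \notin R).
  by have [->|/bfire[k [-> ? _]]//] := eqVneq v ord0; rewrite b0 sink_row.
exists b; split=> // v v0.
have [k [bv oddk cv]] := bfire v v0.
have degv := deg_before_later v bR; have befv := before_previous v bR.
have : before b v = nbrs_in (fired c k) v.
  by rewrite before_nbrs firedE; apply: eq_card => u; rewrite !inE bv.
move=> eqb; apply/andP; split; first by lia.
(* The upper bound says that [v] could not fire two phases earlier. In phases 1 and 2 there is no
   such opportunity, and stability takes its place. *)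
case: k => [|[|k]] in bv oddk cv eqb *.
- have stv := st v v0.
  suff : nbrs_in [set u | (b u).+2 < b v] v = 0 by lia.
  by apply: eq_card0 => u; rewrite !inE bv.
- have stv := st v v0.
  suff : nbrs_in [set u | (b u).+2 < b v] v = 0 by lia.
  by apply: eq_card0 => u; rewrite !inE bv.
have : v \notin fired c k.+1 by rewrite firedE inE bv; lia.
rewrite /= in_setU negb_or inE v0 -oddk /= negbK eqxx /= -ltnNge => /andP[_].
have -> : nbrs_in (fired c k) v = nbrs_in [set u | (b u).+2 < b v] v.
  by rewrite firedE; apply: eq_card => u; rewrite !inE bv.
by lia.
Qed.

Lemma schedule_gt0 c b v : schedule c b -> v != ord0 -> 0 < b v.
Proof.
move=> [_ bR cb] v0; have [vmp|] := posnP (previous b v).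
  by have := cb v v0; lia.
by case/card_gt0P => u; rewrite inE => /andP[_ /eqP<-].
Qed.

Lemma schedule_stable c b : schedule c b -> stable R c.
Proof.
move=> [_ bR cb] v v0; rewrite (deg_before_later v bR) (before_previous v bR).
by have := cb v v0; lia.
Qed.

(** For a vertex of [X] of least phase, all neighbours inside [X] fire later and are covered by the
    lower bound on its load. *)
Lemma schedule_no_forbidden c b : schedule c b -> no_forbidden c.
Proof.
move=> [_ bR cb] X /set0Pn[w wX] oX.
have [v vX vmin] : exists2 v, v \in X & forall u, u \in X -> b v <= b u.
  by case: (arg_minnP (P := fun u => u \in X) b wX) => v; exists v.
exists v => //; have v0 : v != ord0 by apply: contraNneq oX => <-.
have /andP[lv _] := cb v v0; apply: leq_trans lv.
apply/subset_leq_card/subsetP => u; rewrite !inE adjC => /andP[/vmin le vu].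
by have := adj_odd bR vu; rewrite vu; lia.
Qed.

Lemma schedule_fired c b k : schedule c b -> fired c k = [set v | b v <= k].
Proof.
move=> sb; have [b0 bR cb] := sb.
elim: k => [|k IH]; apply/setP => v; 
  (have [->|v0] := eqVneq v ord0; first by rewrite sink_fired inE b0).
  by rewrite !inE; have := schedule_gt0 sb v0; rewrite (negbTE v0); lia.
rewrite /= in_setU {1}IH !inE v0 /= -bR.
have := cb v v0; have := deg_before_later v bR; have := before_previous v bR.
move=> befv degv cv; have [bvk|kv] /= := leqP (b v) k; first by rewrite leqW.
have [bv|/negP nbv] /= := boolP (b v == k.+1).
  rewrite (eqP bv) leqnn eqxx /=.
  have -> : nbrs_in (fired c k) v = before b v.
    by rewrite before_nbrs IH; apply: eq_card => u; rewrite !inE (eqP bv).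
  by lia.
have -> : (b v <= k.+1) = false by lia.
apply/negbTE; rewrite negb_and orbC -ltnNge; case: eqP => [odd_eq|]; last by rewrite orbT.
(* Equal parity puts [b v] at [k.+3] or more, so the fired neighbours precede [v] by at least three
   phases and the upper bound keeps [v] from firing. *)
have : nbrs_in (fired c k) v <= nbrs_in [set u | (b u).+2 < b v] v.
  by apply: nbrs_inS; apply/subsetP => u; rewrite IH !inE; move: odd_eq => /=; lia.
by lia.
Qed.

(** This makes schedules unique: any function satisfying the two load bounds may stand for [blk]. *)
Lemma schedule_blk c b v : schedule c b -> blk c v = b v.
Proof.
move=> sb; apply: blkE.
- exact: schedule_stable sb.
- have : v \in fired c (2 * n) by rewrite fired_full ?inE //; exact: schedule_no_forbidden sb.
  by rewrite (schedule_fired _ sb) inE; lia.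
- by rewrite (schedule_fired _ sb) inE.
- by move=> j; rewrite (schedule_fired _ sb) inE -ltnNge.
Qed.

Lemma schedule_eq c b b' : b =1 b' -> schedule c b -> schedule c b'.
Proof.
move=> bb' [b0 bR cb]; split=> [|v|v v0]; rewrite -?bb' //.
have -> : later b' v = later b v by apply: eq_card => u; rewrite !inE !bb'.
have -> : previous b' v = previous b v by apply: eq_card => u; rewrite !inE !bb'.
exact: cb.
Qed.

Lemma schedule_blkP c : stable R c -> no_forbidden c -> schedule c (blk c).
Proof.
move=> st /(no_forbidden_schedule st)[b sb].
by apply: schedule_eq (sb) => v; rewrite (schedule_blk v sb).
Qed.

Lemma recurrent_schedule c : recurrent R c -> schedule c (blk c).
Proof.
move=> rc; apply: schedule_blkP; first by case: rc => _ [].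
exact: recurrent_no_forbidden.
Qed.

Lemma schedule_recurrent c b : c ord0 = 0 -> schedule c b -> recurrent R c.
Proof.
move=> c0 sb; have [b0 bR cb] := sb; apply: (burning_recurrent (b := b)) => //.
  exact: schedule_stable sb.
by move=> v v0; rewrite (deg_before_later v bR); have := cb v v0; lia.
Qed.

(** The load bounds force a neighbour in the phase just before each non-sink vertex, so one can
    descend one phase at a time. *)
Lemma schedule_surj c b v h : schedule c b -> h <= b v -> exists u, b u = h.
Proof.
move=> sb hv; have [m] := ubnP (b v); elim: m v hv => // m IH v hv bvm.
have [->|neq] := eqVneq h (b v); first by exists v.
have [b0 _ cb] := sb; have v0 : v != ord0.
  by apply: contraNneq neq => v0; move: hv; rewrite v0 b0; lia.
have : 0 < previous b v by have := cb v v0; lia.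
case/card_gt0P => u; rewrite inE => /andP[_ /eqP bu]; apply: (IH u); lia.
Qed.
(** * EW-tableaux as acyclic orientations *)

Definition arc (T : filling n) u v := (cell u v && T (u, v)) || (cell v u && ~~ T (v, u)).

Lemma arc_adj T u v : arc T u v -> adj u v.
Proof. by rewrite /Defs.adj => /orP[]/andP[-> _]; rewrite ?orbT. Qed.

Lemma cell_asym u v : cell u v -> cell v u = false.
Proof. by case/and3P=> uR vR _; rewrite /Defs.cell uR andbF. Qed.

Lemma arcN T u v : adj u v -> arc T u v = ~~ arc T v u.
Proof.
by rewrite /arc => /orP[] uv; rewrite uv (cell_asym uv) /= ?orbF ?negbK.
Qed.

Lemma arc_row T u v : v \in R -> arc T u v = cell v u && ~~ T (v, u).
Proof. by rewrite /arc /Defs.cell => ->; rewrite andbF. Qed.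

Lemma arc_col T u v : v \notin R -> arc T u v = cell u v && T (u, v).
Proof. by rewrite /arc /Defs.cell => /negbTE->; rewrite orbF. Qed.

Lemma phiTC_arc T v : v != ord0 -> phiTC R T v = #|[set u | arc T v u]|.
Proof.
move=> v0; rewrite ffunE (negbTE v0).
case: ifP => vR; apply: eq_card => u; rewrite !inE /arc.
  by rewrite [cell u v]/Defs.cell vR andbF orbF.
by rewrite [cell v u]/Defs.cell vR.
Qed.

Definition order_filling b : filling n := [ffun p => cell p.1 p.2 && (b p.1 < b p.2)].

Lemma arc_order b u v : (forall v, odd (b v) = (v \notin R)) ->
  arc (order_filling b) u v = adj u v && (b u < b v).
Proof.
move=> bR; rewrite /arc !ffunE /=; case auv: (adj u v).
  have := adj_odd bR auv; case/orP: (auv) => uv; rewrite uv (cell_asym uv) /= ?orbF //.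
  by lia.
by move/negbT: auv; rewrite negb_or => /andP[/negbTE-> /negbTE->].
Qed.

Lemma phiTC_order b v : (forall v, odd (b v) = (v \notin R)) -> v != ord0 ->
  phiTC R (order_filling b) v = later b v.
Proof.
by move=> bR v0; rewrite phiTC_arc //; apply: eq_card => u; rewrite !inE arc_order.
Qed.

Lemma order_filling_EW c b : schedule c b -> isEW R (order_filling b).
Proof.
move=> sb; have [b0 bR cb] := sb; apply/and4P; split.
- by do 2!apply/forallP => ?; apply/implyP => ncell; rewrite ffunE /= (negbTE ncell).
- apply/forallP => j; apply/implyP => c0j; rewrite ffunE /= c0j b0.
  by apply: schedule_gt0 sb _; apply: contraTneq c0j => ->; rewrite /Defs.cell ltnn !andbF.
- apply/forallP => i; apply/implyP => /andP[iR i0].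
  have : 0 < previous b i by have := cb i i0; lia.
  case/card_gt0P => u; rewrite inE => /andP[aiu /eqP bu].
  apply/existsP; exists u; rewrite -arc_row // arc_order // adjC aiu -bu.
  exact: ltnSn.
(* An alternating rectangle would close a cycle of inequalities among the phases of its rows and
   columns. *)
do 4!apply/forallP => ?; apply/implyP => /and5P[c1 c2 c3 c4 _].
by rewrite !ffunE /= c1 c2 c3 c4 /=; lia.
Qed.

(* A nonempty set closed under taking a predecessor is not minimal: if [i] is its top
   row, the columns pointing to [i] and the rows pointing to them form a smaller one,
   since an arc leading back to another column would close an alternating rectangle. *)
Lemma EW_no_cycle T X : isEW R T ->
  (forall v, v \in X -> exists2 u, u \in X & arc T u v) -> X = set0.
Proof.
case/and4P=> _ _ _ rect; have [m] := ubnP #|X|; elim: m X => // m IH X ltm pX.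
apply/eqP/negPn/negP => /set0Pn[w wX].
have [i [iX iR imin]] : exists i, [/\ i \in X, i \in R
    & forall u, u \in X -> u \in R -> (i <= u)%N].
  have [w' w'X] : exists w', (w' \in X) && (w' \in R).
    have [wR|wR] := boolP (w \in R); first by exists w; rewrite wX.
    have [u uX] := pX w wX; rewrite arc_col // => /andP[/and3P[uR _ _] _].
    by exists u; rewrite uX.
  case: (arg_minnP (P := fun u => (u \in X) && (u \in R)) (fun u => nat_of_ord u) w'X).
  move=> i /andP[iX iR] imin; exists i; split=> // u uX uR.
  by apply: imin; rewrite uX.
pose C := [set j in X | cell i j && ~~ T (i, j)].
pose Y := C :|: [set k in X | (k \in R) && [exists j in C, arc T k j]].
have iY : i \notin Y.
  rewrite !inE /Defs.cell ltnn !andbF /= iX iR /=.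
  apply/existsP => -[j /andP[]]; rewrite inE => /andP[_].
  by rewrite -arc_row // => aji; rewrite arcN ?aji // adjC (arc_adj aji).
have sYX : Y \subset X.
  by apply/subsetP => v; rewrite !inE => /orP[] /andP[].
have Y0 : Y = set0.
  apply: IH.
    rewrite -ltnS; apply: leq_trans ltm; rewrite ltnS; apply: proper_card.
    by rewrite properE sYX; apply/subsetPn; exists i.
  move=> v; rewrite in_setU => /orP[vC|].
    have /pX[u uX auv] : v \in X by move: vC; rewrite inE => /andP[].
    have vR : v \notin R by move: vC; rewrite inE => /and3P[_ /and3P[]].
    exists u => //; rewrite !inE uX; apply/orP; right.
    have -> : u \in R by move: auv; rewrite arc_col // => /andP[/and3P[]].
    by apply/existsP; exists v; rewrite vC.
  rewrite inE => /and3P[vX vR /existsP[j /andP[jC avj]]].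
  have [u uX auv] := pX v vX; exists u => //; apply/setUP; left; rewrite inE uX /=.
  move: auv jC; rewrite arc_row // inE => /andP[cvu Tvu] /and3P[jX cij Tij].
  have [uR vu] : u \notin R /\ v < u by case/and3P: cvu.
  (* Since [i] is the top row of [X], a column meeting row [v] also meets row [i]. *)
  have ciu : cell i u by rewrite /Defs.cell iR uR (leq_ltn_trans (imin v vX vR)).
  have [cvj Tvj] : cell v j /\ T (v, j).
    by apply/andP; rewrite -arc_col //; case/and3P: cij.
  rewrite ciu; apply/negP => Tiu.
  have /forallP/(_ i)/forallP/(_ v)/forallP/(_ j)/forallP/(_ u) := rect.
  rewrite cij ciu cvj cvu Tij Tvu Tiu Tvj !andbT /= implybF.
  case: (i =P v) => [iv|_]; first by rewrite iv Tvj in Tij.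
  by case: (j =P u) => [ju|_] //; rewrite ju Tiu in Tij.
have [u uX] := pX i iX; rewrite arc_row // => uC.
suff : u \in Y by rewrite Y0 inE.
by rewrite !inE uX uC.
Qed.

(** The load of a vertex is its out-degree. It is stable because every non-sink vertex has an
    incoming arc, and acyclicity gives each [X] a source, whose neighbours in [X] all lie at the end
    of outgoing arcs. *)
Lemma EW_schedule T : isEW R T -> schedule (phiTC R T) (blk (phiTC R T)).
Proof.
move=> ew; have /and4P[_ /forallP top0 /forallP zero _] := ew; apply: schedule_blkP.
  move=> v v0; rewrite phiTC_arc //; apply: proper_card; rewrite properE; apply/andP; split.
    by apply/subsetP => u; rewrite !inE; exact: arc_adj.
  suff [u auv] : exists u, arc T u v.
    have vu : adj v u by rewrite adjC (arc_adj auv).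
  by apply/subsetPn; exists u; rewrite inE // arcN ?auv.
  have [vR|vR] := boolP (v \in R).
    have := zero v; rewrite vR v0 => /existsP[u]; exists u.
    by rewrite arc_row.
  exists ord0; rewrite arc_col //.
  have c0v : cell ord0 v.
    by case/orP: (adj_sink vR) => // /and3P[]; rewrite sink_row.
  by have := top0 v; rewrite c0v.
move=> X X0 oX; have [/existsP[v /andP[vX /forallP srcv]]|] :=
  boolP [exists v in X, [forall u, (u \in X) ==> ~~ arc T u v]].
  exists v => //; have v0 : v != ord0 by apply: contraNneq oX => <-.
  rewrite phiTC_arc //; apply/subset_leq_card/subsetP => u.
  rewrite !inE => /andP[uX auv]; rewrite arcN; last by rewrite adjC.
  by have := srcv u; rewrite uX.
rewrite negb_exists => /forallP noX; case/negP: X0; apply/eqP.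
apply: (EW_no_cycle ew) => v vX; have := noX v; rewrite vX /= negb_forall.
by case/existsP => u; rewrite negb_imply negbK => /andP[uX auv]; exists u.
Qed.

(** By induction on phases, earlier neighbours point to [v], so arcs leaving [v] end at later
    vertices; the schedule bounds the out-degree below by the number of those, whence equality. *)
Lemma EW_arc T u v : isEW R T ->
  arc T v u = adj v u && (blk (phiTC R T) v < blk (phiTC R T) u).
Proof.
move=> ew; have sb := EW_schedule ew; move: (blk _) sb => b sb.
have [b0 bR cb] := sb; have [m] := ubnP (b v); elim: m v u => // m IH v u bvm.
have sub w : arc T v w -> adj v w && (b v < b w).
  move=> avw; have vw := arc_adj avw; rewrite vw ltnNge leq_eqVlt negb_or /=.
  apply/andP; split; first by have := adj_odd bR vw; lia.
  apply: contraL avw => bwv; rewrite arcN // negbK (IH w v) 1?adjC ?vw //.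
  exact: leq_trans bwv bvm.
(* The schedule gives no bound at the sink; there the top row of 1s decides. *)
have [v0|v0] := eqVneq v ord0.
  apply/idP/idP => [/sub//|/andP[]]; rewrite v0 b0 => a0u bu.
  have uR : u \notin R by rewrite -(negbK (u \in R)) -(adj_parity a0u) sink_row.
  rewrite arc_col //; have /and4P[_ /forallP/(_ u) + _ _] := ew.
  have -> : cell ord0 u by case/orP: a0u => // /and3P[]; rewrite (negbTE uR).
  exact.
suff /setP/(_ u) : [set w | arc T v w] = [set w | adj v w & b v < b w] by rewrite !inE.
apply/eqP; rewrite eqEcard; apply/andP; split.
  by apply/subsetP => w; rewrite !inE; exact: sub.
by rewrite -phiTC_arc //; case/andP: (cb v v0).
Qed.

Lemma EW_order T : isEW R T -> order_filling (blk (phiTC R T)) = T.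
Proof.
move=> ew; apply/ffunP => -[i j]; rewrite ffunE /=.
case cij: (cell i j) => /=; last first.
  have /and4P[/forallP/(_ i)/forallP/(_ j) + _ _ _] := ew.
  by rewrite cij /= => /negbTE.
have := EW_arc j i ew; rewrite {1}/arc /Defs.adj cij (cell_asym cij) /= orbF.
by move=> ->.
Qed.

(** * The inverse bijection, [minrec] and [nu] *)

Lemma phiCT_phiTC T : isEW R T -> phiCT R (phiTC R T) = T.
Proof.
(* A tableau is recovered from the canonical toppling of its configuration, so [pick] can only
   return [T]. *)
move=> ew; rewrite /phiCT; case: pickP => [T' /andP[ew' /eqP eqm]|/(_ T)].
  by rewrite /= -(EW_order ew') eqm EW_order.
by rewrite ew eqxx.
Qed.

Lemma phiTC_order_schedule c b : schedule c b -> schedule (phiTC R (order_filling b)) b.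
Proof.
move=> [b0 bR cb]; split=> // v v0; rewrite phiTC_order //.
by have := cb v v0; lia.
Qed.

Lemma minrec_schedule c b : schedule c b -> minrec R c = phiTC R (order_filling b).
Proof.
move=> sb; have [b0 bR cb] := sb; apply/ffunP => v; rewrite !ffunE.
case: ifP => // _; case: ifP => vR; apply: eq_card => u;
  rewrite !inE !ffunE /= !(schedule_blk _ sb) ?bR /Defs.cell vR.
- by case: (u \in R); case: (v < u).
have [uR|] /= := boolP (u \in R); last by rewrite ?andbF.
case: (u < v) => //=; have := bR u; have := bR v; rewrite uR vR /=; lia.
Qed.

(** A corner support of the entry for an arc from [u] to [v] requires a row and a column with phases
    strictly between those of [u] and [v]. By parity such phases exist as soon as the two are not
    consecutive, and no phase in between is empty. *)
Lemma nu_previous T v : isEW R T -> v != ord0 -> nu R T v = previous (blk (phiTC R T)) v.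
Proof.
move=> ew v0; have sb := EW_schedule ew; have arcE u w := EW_arc w u ew.
rewrite /nu /cornersupport /suppl.
move: (blk _) sb arcE => b sb arcE; have [b0 bR cb] := sb.
have neq_b u w : b u != b w -> u != w by apply: contraNneq => ->.
have step u w : adj u w -> b u < b w -> (b u).+1 != b w ->
    exists p q, [/\ b p = (b u).+1, b q = (b u).+2 & (b u).+2 < b w].
  move=> uw ltuw nequw; have odduw := adj_odd bR uw.
  have ltw : (b u).+2 < b w by lia.
  have [p bp] : exists p, b p = (b u).+1 by apply: (schedule_surj sb (v := w)); lia.
  have [q bq] : exists q, b q = (b u).+2 by apply: (schedule_surj sb (v := w)); lia.
  by exists p, q.
have prevE u : adj v u && ((b u).+1 == b v) = arc T u v && ((b u).+1 == b v).
  by rewrite adjC arcE; case: (adj u v) => //=; lia.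
case: ifP => vR; apply: eq_card => u; rewrite !inE prevE andbA -?arc_row -?arc_col ?vR //;
  case auv: (arc T u v) => //=; have := auv; rewrite arcE => /andP[uv ltuv];
  have odduv := adj_odd bR uv; have := bR v; rewrite vR => oddv;
  apply/negP/idP => [ncs|/eqP buv].
- apply: contraT => /(step _ _ uv ltuv)[p [q [bp bq ltq]]]; case: ncs.
  move: auv; rewrite arc_row // => /andP[_ /negbTE->].
  apply/existsP; exists p; apply/existsP; exists q; apply/and5P.
  have := bR p; have := bR q; move: (p \in R) (q \in R) => [] [] //=; try by lia.
  by split=> //; [apply: neq_b; lia | apply: neq_b; lia | lia].
- case/existsP=> p /existsP[q /and5P[pR qR _ _]].
  move: auv; rewrite arc_row // => /andP[_ /negbTE->].
  by have := bR p; rewrite pR; lia.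
- apply: contraT => /(step _ _ uv ltuv)[q [p [bq bp ltp]]]; case: ncs.
  move: auv; rewrite arc_col ?vR // => /andP[_ ->].
  apply/existsP; exists p; apply/existsP; exists q; apply/and5P.
  have := bR p; have := bR q; move: (p \in R) (q \in R) => [] [] //=; try by lia.
  by split=> //; [apply: neq_b; lia | apply: neq_b; lia | lia].
- case/existsP=> p /existsP[q /and5P[pR qR _ _]].
  move: auv; rewrite arc_col ?vR // => /andP[_ ->].
  by have := bR p; rewrite pR; lia.
Qed.

End Sandpile.

Theorem theorem4p12 (n : nat) (R : {set 'I_n.+1}) (T : filling n) (a : config n) :
  ferrers R -> isDecEW R T a ->
  (RecEW R (T, a) <-> forall j : 'I_n.+1, j != ord0 -> a j < nu R T j).
Proof.
move=> F [ew [a0 _]]; split=> [[x [rx]]|lt_a].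
  have sb := recurrent_schedule F rx; move: (blk R x) sb => b sb.
  have [b0 bR cb] := sb.
  rewrite /psi (minrec_schedule sb) phiCT_phiTC //; last exact: order_filling_EW sb.
  move=> [defT defa] j j0; rewrite nu_previous // -defT -defa ffunE.
  (* The least loads have the same schedule as [x], so [nu] can be read off from [b]. *)
  have sT := phiTC_order_schedule sb.
  rewrite phiTC_order //.
  have -> : previous R (blk R (phiTC R (order_filling R b))) j = previous R b j.
    by apply: eq_card => u; rewrite !inE !(schedule_blk _ sT).
  by have := cb j j0; lia.
have sb := EW_schedule F ew; have ordT := EW_order F ew.
have nuE := nu_previous F ew.
move: (blk R _) sb ordT nuE => b sb ordT nuE; have [b0 bR _] := sb.
(* The only possible preimage; the bound on [a] is exactly what keeps [b] its schedule. *)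
pose x := addc (phiTC R T) a.
have sx : schedule R x b.
  split=> // v v0; have := lt_a v v0; rewrite nuE // ffunE -(phiTC_order bR v0) ordT.
  by lia.
exists x; split; first by apply: schedule_recurrent sx => //; rewrite !ffunE a0.
rewrite /psi (minrec_schedule sx) ordT phiCT_phiTC //; congr pair.
by apply/ffunP => v; rewrite !ffunE addKn.
Qed.
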